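(* $\mathrm{Fin}(11)=\mathrm{Adm}(11)\setminus\{(3,0),(4,0),(4,6),(5,0),(5,1),(5,2),(6,0),(6,1),(6,3),(6,4)\}$.
   Context: $K_4-e$ is the graph on four vertices $a,b,c,d$ with edges $ab,ac,ad,bc,bd$; it is denoted $[a,b,c-d]$. A $(K_4-e)$-design of order $v$ is a pair $(X,\mathcal B)$ where $X$ is a set of $v$ vertices and $\mathcal B$ is a collection of copies of $K_4-e$ (blocks) with vertices in $X$ whose edge sets partition the edges of $K_v$ on $X$; it has $b_v=v(v-1)/10$ blocks. For a graph $B$, $T(B)$ is the set of its triangles (3-vertex subsets inducing a triangle); e.g. $T([a,b,c-d])=\{\{a,b,c\},\{a,b,d\}\}$, and $T(\mathcal B)=\bigcup_{B\in\mathcal B}T(B)$. Two designs $(X,\mathcal B_1),(X,\mathcal B_2)$ on the same vertex set intersect in $s$ blocks if $|\mathcal B_1\cap\mathcal B_2|=s$, and in $t$ triangles if $|T(\mathcal B_1)\cap T(\mathcal B_2)|=t$. Define $\mathrm{Fin}(v)=\{(s,t):$ there exists a pair of $(K_4-e)$-designs of order $v$ on the same vertex set intersecting in $s$ blocks and $t+2s$ triangles$\}$; $J(v)=\{s:$ there is a pair of $(K_4-e)$-designs of order $v$ intersecting in $s$ blocks$\}$; $J_T(v)=\{t:$ there is a pair of $(K_4-e)$-designs of order $v$ intersecting in $t$ triangles$\}$; and $\mathrm{Adm}(v)=\{(s,t): s,t\ge 0,\ s+t\le b_v,\ s\in J(v),\ t+2s\in J_T(v)\}$. (Known from the literature: $J(11)=\{0,1,\dots,6,11\}$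 and $J_T(11)=\{0,1,\dots,16,22\}$.) *)

(* Defs.v *)
From mathcomp Require Import all_boot.
Set Implicit Arguments. Unset Strict Implicit. Unset Printing Implicit Defensive.

(* Vertex set X = 'I_v (any v-set; designs are compared on the same vertex set).
   A graph on X is given by its edge set, a set of 2-subsets of X. *)
Definition graph (v : nat) := {set {set 'I_v}}.

Definition K4e (v : nat) (a b c d : 'I_v) : graph v :=
  [set [set a; b]; [set a; c]; [set a; d]; [set b; c]; [set b; d]].

Definition is_K4e (v : nat) (B : graph v) : Prop :=
  exists a b c d : 'I_v, [/\ uniq [:: a; b; c; d] & B = K4e a b c d].

Definition is_design (v : nat) (blocks : {set graph v}) : Prop :=
  (forall B, B \in blocks -> is_K4e B) /\
  (forall e : {set 'I_v}, #|e| = 2 ->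
     exists! B, B \in blocks /\ e \in B) /\
  (forall B1 B2, B1 \in blocks -> B2 \in blocks -> B1 != B2 ->
     [disjoint B1 & B2]).

Definition triangles (v : nat) (B : graph v) : {set {set 'I_v}} :=
  [set t : {set 'I_v} | (#|t| == 3) &&
     [forall x in t, forall y in t, (x != y) ==> ([set x; y] \in B)]].

Definition Tset (v : nat) (blocks : {set graph v}) : {set {set 'I_v}} :=
  \bigcup_(B in blocks) triangles B.

Definition bv (v : nat) : nat := v * (v - 1) %/ 10.

Definition Fin (v : nat) (s t : nat) : Prop :=
  exists B1 B2 : {set graph v}, [/\ is_design B1, is_design B2,
     #|B1 :&: B2| = s & #|Tset B1 :&: Tset B2| = t + 2 * s].

Definition J (v : nat) (s : nat) : Prop :=
  exists B1 B2 : {set graph v}, [/\ is_design B1, is_design B2 & #|B1 :&: B2| = s].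

Definition JT (v : nat) (t : nat) : Prop :=
  exists B1 B2 : {set graph v},
    [/\ is_design B1, is_design B2 & #|Tset B1 :&: Tset B2| = t].

Definition Adm (v : nat) (s t : nat) : Prop :=
  s + t <= bv v /\ J v s /\ JT v (t + 2 * s).

(* Main.v *)
Require Import Defs.
From mathcomp Require Import all_boot.
From mathcomp Require Import zify.
Set Implicit Arguments. Unset Strict Implicit. Unset Printing Implicit Defensive.

(* Each vertex has degree 10 and occurs with degree 3 or 2 in the blocks containing
   it; a parity count forces it to have degree 3 in exactly two blocks. Hence the
   edges [ab] of the blocks [a,b,c-d] form a 2-factor of K_11. Once this 2-factor
   is fixed, every other edge lies in one of only four possible triangles, and a
   tiny exhaustive search shows that the 2-factor is a Hamiltonian cycle and that
   the design is circulant: up to relabelling its blocks are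
   [k,k+1,k+3-(k+w)] mod 11 with w = 5 or w = 7.
   Two designs with a common block can be rotated so that the block k = 0 of one
   is the block k = 0 of the other, which leaves 4 * 7! relative labellings for
   each pair of types; enumerating them settles the pairs with s >= 3. Finally
   s + t <= 11 because two triangles of one block that both occur in the other
   design share an edge, so they form a block of it. *)

(** * Blocks *)

Lemma set2_eq (T : finType) (a b c d : T) :
  ([set a; b] == [set c; d]) =
  ((a == c) && (b == d)) || ((a == d) && (b == c)).
Proof.
apply/eqP/idP => [E|]; last by case/orP=> /andP[/eqP-> /eqP->]; rewrite 1?setUC.
have : a \in [set c; d] by rewrite -E set21.
have : b \in [set c; d] by rewrite -E set22.
have : c \in [set a; b] by rewrite E set21.
have : d \in [set a; b] by rewrite E set22.
rewrite !inE (eq_sym c a) (eq_sym c b) (eq_sym d a) (eq_sym d b).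
by case: (a == c); case: (b == d); case: (a == d); case: (b == c).
Qed.

Section Blocks.
Variable v : nat.
Implicit Types (a b c d x y z : 'I_v) (B : graph v).

Lemma K4eC a b c d : K4e b a c d = K4e a b c d.
Proof.
apply/setP=> e; rewrite !inE (setUC [set b]); case: (e == [set a; b]) => //=.
by case: (e == [set a; c]); case: (e == [set a; d]); case: (e == [set b; c]);
  rewrite ?orbT ?orbF.
Qed.

Lemma K4eCr a b c d : K4e a b d c = K4e a b c d.
Proof.
apply/setP=> e; rewrite !inE; case: (e == [set a; b]) => //=.
by case: (e == [set a; c]); case: (e == [set a; d]); case: (e == [set b; c]);
  rewrite ?orbT ?orbF.
Qed.

Lemma sum_K4e a b c d (F : {set 'I_v} -> nat) : uniq [:: a; b; c; d] ->
  \sum_(e in K4e a b c d) F e =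
  F [set a; b] + F [set a; c] + F [set a; d] + F [set b; c] + F [set b; d].
Proof.
move=> U; rewrite /K4e -!setUA.
have /= := U; rewrite !inE !negb_or => /and4P[/and3P[ab ac ad] /andP[bc bd] cd _].
have E := (negbTE ab, negbTE ac, negbTE ad, negbTE bc, negbTE bd, negbTE cd).
rewrite !big_setU1 ?big_set1; first by rewrite /= !addnA.
all: by rewrite ?inE ?set2_eq ?(eq_sym b a) ?(eq_sym c b) ?E ?andbF ?eqxx ?E.
Qed.

Lemma card_K4e a b c d : uniq [:: a; b; c; d] -> #|K4e a b c d| = 5.
Proof. by move=> U; rewrite -sum1_card sum_K4e. Qed.

Definition degree B x := \sum_(e in B) (x \in e).

Lemma degree_K4e a b c d x : uniq [:: a; b; c; d] ->
  degree (K4e a b c d) x = if x \in [set a; b] then 3 else 2 * (x \in [set c; d]).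
Proof.
move=> U; rewrite /degree sum_K4e // !inE.
move: U; rewrite /= !inE !negb_or => /and4P[/and3P[ab ac ad] /andP[bc bd] cd _].
case: (eqVneq x a) => [->|_]; first by rewrite (negbTE ab) (negbTE ac) (negbTE ad).
case: (eqVneq x b) => [->|_]; first by rewrite (negbTE bc) (negbTE bd).
case: (eqVneq x c) => [->|_]; first by rewrite (negbTE cd).
by case: eqP.
Qed.

(** The central edge has to be read off the edge set alone; its ends are the vertices of degree
    3. *)
Definition core B := [set x | degree B x == 3].

Lemma core_K4e a b c d : uniq [:: a; b; c; d] -> core (K4e a b c d) = [set a; b].
Proof.
move=> U; apply/setP=> x; rewrite inE degree_K4e // !inE.
by case: ((x == a) || (x == b)) => //; case: ((x == c) || (x == d)).
Qed.

(** The degrees recover both pairs from the edge set: the central pair is the core, the outer pair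
    consists of the vertices of positive degree outside it. *)
Lemma K4e_eq a b c d a' b' c' d' :
  uniq [:: a; b; c; d] -> uniq [:: a'; b'; c'; d'] ->
  (K4e a b c d == K4e a' b' c' d') =
  ([set a; b] == [set a'; b']) && ([set c; d] == [set c'; d']).
Proof.
move=> U U'; apply/eqP/andP => [E|[]]; last first.
  rewrite !set2_eq => /orP[] /andP[/eqP<- /eqP<-] /orP[] /andP[/eqP<- /eqP<-];
    by rewrite ?[K4e b a _ _]K4eC ?[K4e _ _ d c]K4eCr.
split; first by rewrite -(core_K4e U) E core_K4e.
have sub p q r s : uniq [:: p; q; r; s] -> [set r; s] =
    [set x in ~: core (K4e p q r s) | 0 < degree (K4e p q r s) x].
  move=> Up; apply/setP=> x; rewrite in_set in_setC core_K4e // degree_K4e //.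
  move: Up; rewrite /= !inE !negb_or => /and4P[/and3P[_ pr ps] /andP[qr qs] _ _].
  case: (eqVneq x p) => [->|_] /=; first by rewrite (negbTE pr) (negbTE ps).
  case: (eqVneq x q) => [->|_] /=; first by rewrite (negbTE qr) (negbTE qs).
  by case: ((x == r) || (x == s)).
by rewrite (sub _ _ _ _ U) (sub _ _ _ _ U') E.
Qed.

Lemma set3_eq (T : finType) (a b c x y z : T) : uniq [:: x; y; z] ->
  uniq [:: a; b; c] ->
  ([set x; y; z] == [set a; b; c]) =
  [&& x \in [:: a; b; c], y \in [:: a; b; c] & z \in [:: a; b; c]].
Proof.
move=> U U'.
have E (p q r : T) : [set p; q; r] = [set u in [:: p; q; r]].
  by apply/setP=> u; rewrite !inE orbA.
rewrite !E eqEcard !cardsE !(card_uniqP _) // leqnn andbT.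
apply/subsetP/and3P=> [S|[X Y Z] u].
  by split; [move: (S x)|move: (S y)|move: (S z)]; rewrite !inE eqxx ?orbT;
    apply.
rewrite !in_set in_cons => /orP[/eqP->//|].
by rewrite in_cons => /orP[/eqP->//|]; rewrite mem_seq1 => /eqP->.
Qed.

(** The pair cd is the missing edge, so a triangle omits [c] or [d]; its three vertices are then
    forced. *)
Lemma triangles_K4e a b c d : uniq [:: a; b; c; d] ->
  triangles (K4e a b c d) = [set [set a; b; c]; [set a; b; d]].
Proof.
move=> U; have /= := U; rewrite !inE !negb_or.
move=> /and4P[/and3P[ab ac ad] /andP[bc bd] cd _].
have E := (negbTE ab, negbTE ac, negbTE ad, negbTE bc, negbTE bd, negbTE cd).
have E' := (eq_sym b a, eq_sym c b, eq_sym c a, eq_sym d a, eq_sym d b, eq_sym d c).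
apply/setP=> t; rewrite inE in_set2; apply/andP/orP=> [[t3 /forall_inP tB]|].
  have mB x y : x \in t -> y \in t -> x != y -> [set x; y] \in K4e a b c d.
    by move=> xt yt; move/forall_inP/(_ y yt)/implyP: (tB x xt).
  have sub : t \subset [set a; b; c; d].
    apply/subsetP=> x xt.
    have: 0 < #|t :\ x| by have := cardsD1 x t; rewrite xt (eqP t3) add1n => -[<-].
    rewrite card_gt0 => /set0Pn[y]; rewrite !inE => /andP[yx yt].
    move: (mB y x yt xt yx); rewrite !inE !set2_eq.
    by case: (x == a); case: (x == b); case: (x == c); case: (x == d); rewrite ?andbF.
  have [ct|ct] := boolP (c \in t); [left|right]; rewrite eqEcard (eqP t3).
    have dt : d \notin t.
      by apply/negP=> dt; move: (mB c d ct dt cd); rewrite !inE !set2_eq ?E' ?E ?eqxx ?andbF.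
    rewrite (leq_trans (leq_card_setU _ _)) ?cards2 ?cards1 ?ab // andbT.
    apply/subsetP=> x xt; have := subsetP sub x xt; rewrite !inE.
    by case: (eqVneq x d) => [xd|_]; [rewrite -xd xt in dt | rewrite orbF].
  rewrite (leq_trans (leq_card_setU _ _)) ?cards2 ?cards1 ?ab // andbT.
  apply/subsetP=> x xt; have := subsetP sub x xt; rewrite !inE.
  by case: (eqVneq x c) => [xc|_]; [rewrite -xc xt in ct | rewrite orbF].
have main z : uniq [:: a; b; z] -> [set a; z] \in K4e a b c d ->
   [set b; z] \in K4e a b c d -> t == [set a; b; z] ->
   #|t| == 3 /\ [forall x in t, forall y in t, (x != y) ==> ([set x; y] \in K4e a b c d)].
  move=> Uz az bz /eqP->.
  have abB : [set a; b] \in K4e a b c d by rewrite !inE eqxx.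
  have -> : [set a; b; z] = [set u in [:: a; b; z]] by apply/setP=> u; rewrite !inE orbA.
  rewrite cardsE (card_uniqP Uz); split=> //.
  have inE3 x : x \in [set u in [:: a; b; z]] -> [\/ x = a, x = b | x = z].
    by rewrite !inE => /or3P[] /eqP->; [constructor 1|constructor 2|constructor 3].
  apply/forall_inP=> x /inE3 xt; apply/forall_inP=> y /inE3 yt; apply/implyP.
  by case: xt yt => -> [] ->; rewrite ?eqxx // => _; rewrite setUC.
by case; apply: main; rewrite ?inE ?eqxx ?orbT //= ?inE ?E.
Qed.
End Blocks.

(** * The 2-factor of central edges *)

Section Design.
Variables (v : nat) (D : {set graph v}).
Hypothesis desD : is_design D.
Implicit Types (x y z : 'I_v) (B : graph v) (e : {set 'I_v}).

Lemma design_K4e B : B \in D ->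
  exists a b c d : 'I_v, uniq [:: a; b; c; d] /\ B = K4e a b c d.
Proof. by case: desD => H _ /H[a [b [c [d [U E]]]]]; exists a, b, c, d. Qed.

Lemma design_edge_uniq B1 B2 e :
  B1 \in D -> B2 \in D -> e \in B1 -> e \in B2 -> B1 = B2.
Proof.
case: desD => _ [_ dis] D1 D2 e1 e2; apply/eqP/negPn/negP=> ne.
by move: (dis _ _ D1 D2 ne); rewrite disjoint_subset => /subsetP/(_ e e1); rewrite inE e2.
Qed.

Lemma design_cover e : #|e| = 2 -> exists2 B, B \in D & e \in B.
Proof. by case: desD => _ [ex _] /ex[B [[BD eB] _]]; exists B. Qed.

Lemma K4e_edge_card B e : B \in D -> e \in B -> #|e| = 2.
Proof.
move=> /design_K4e[a [b [c [d [U ->]]]]].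
move: U; rewrite /= !inE !negb_or.
move=> /and4P[/and3P[ab ac ad] /andP[bc bd] cd _].
by case/orP=> [/orP[/orP[/orP[]|]|]|] /eqP->; rewrite cards2 ?ab ?ac ?ad ?bc ?bd.
Qed.

(** Double counting: the blocks partition the edges. Constant weight yields the number of blocks,
    incidence with a vertex yields its degree equation. *)
Lemma sum_edges (F : {set 'I_v} -> nat) :
  \sum_(B in D) \sum_(e in B) F e = \sum_(e : {set 'I_v} | #|e| == 2) F e.
Proof.
have triv : trivIset D.
  apply/trivIsetP=> B1 B2 D1 D2; case: desD => _ [_]; exact.
rewrite -(big_trivIset _ triv) /=; apply: eq_bigl => e.
apply/bigcupP/eqP=> [[B BD]|/design_cover[B BD eB]]; last by exists B.
exact: K4e_edge_card.
Qed.

Lemma card_design : 5 * #|D| = 'C(v, 2).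
Proof.
have := sum_edges (fun=> 1); rewrite sum1dep_card card_draws card_ord => <-.
rewrite mulnC -sum_nat_const; apply: eq_bigr => B /design_K4e[a [b [c [d [U ->]]]]].
by rewrite sum1_card card_K4e.
Qed.

Lemma sum_degree x : \sum_(B in D) degree B x = v.-1.
Proof.
rewrite sum_edges -big_mkcondr /= sum1dep_card.
have -> : #|[set e : {set 'I_v} | #|e| == 2 & x \in e]| = #|[set [set x; y] | y in [set~ x]]|.
  apply: eq_card => e; rewrite inE; apply/andP/imsetP=> [[/cards2P[a [b [ab ->]]]]|[y]].
    rewrite !inE => /orP[] /eqP->; first by exists b; rewrite // !inE eq_sym.
    by exists a; rewrite ?inE // setUC.
  by rewrite !inE => yx ->; rewrite cards2 (eq_sym x) yx set21.
rewrite card_in_imset ?cardsC1 ?card_ord // => y z; rewrite !inE => yx zx /eqP.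
by rewrite set2_eq eqxx (negbTE yx) andbF orbF => /eqP.
Qed.

Definition central_count x := #|[set B in D | x \in core B]|.

(** The witness [q] counts the blocks in which [x] has degree 2. *)
Lemma central_count_degree x : exists q, 3 * central_count x + 2 * q = v.-1.
Proof.
exists #|[set B in D | degree B x == 2]|.
rewrite -(sum_degree x) /central_count -!sum1dep_card !big_mkcondr /= !big_distrr /=.
rewrite -big_split /=; apply: eq_bigr => B /design_K4e[a [b [c [d [U ->]]]]].
by rewrite inE degree_K4e //; case: (x \in [set a; b]); case: (x \in [set c; d]).
Qed.

Lemma sum_central_count : \sum_x central_count x = 2 * #|D|.
Proof.
rewrite mulnC -sum_nat_const.
under eq_bigr do rewrite /central_count -sum1dep_card big_mkcondr /=.
rewrite exchange_big /=; apply: eq_bigr => B /design_K4e[a [b [c [d [U ->]]]]].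
rewrite -big_mkcond /= sum1_card core_K4e // cards2.
by move: U; rewrite /= !inE !negb_or => /andP[/and3P[-> _ _] _].
Qed.

(** The roles matter: [x], [y] span the central edge of a block and [z], the apex, is one of its
    outer vertices. *)
Definition tri x y z := [exists d, uniq [:: x; y; z; d] && (K4e x y z d \in D)].
Definition cen x y := [exists z, tri x y z].

Lemma triP x y z : reflect (exists d, uniq [:: x; y; z; d] /\ K4e x y z d \in D) (tri x y z).
Proof. by apply: (iffP existsP) => [][d]; [move/andP|move=> H]; exists d => //; apply/andP. Qed.

Lemma tri_sym x y z : tri x y z -> tri y x z.
Proof.
case/triP=> d [U BD]; apply/triP; exists d; rewrite K4eC; split=> //.
by move: U; rewrite /= !inE !negb_or (eq_sym y x) => /and4P[/and3P[-> -> ->] /andP[-> ->] -> _].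
Qed.

Lemma tri_neq x y z : tri x y z -> [/\ x != y, x != z & y != z].
Proof.
case/triP=> d [U _]; move: U; rewrite /= !inE !negb_or.
by case/and4P=> [/and3P[-> -> _] /andP[-> _] _ _].
Qed.

Lemma cen_sym x y : cen x y = cen y x.
Proof. by apply/existsP/existsP=> -[z /tri_sym]; exists z. Qed.

Lemma cen_neq x y : cen x y -> x != y.
Proof. by case/existsP=> z /tri_neq[]. Qed.

Lemma tri_cover x y : x != y ->
  cen x y \/ exists z, tri x z y \/ tri y z x.
Proof.
move=> xy; have [|B BD] := @design_cover [set x; y]; first by rewrite cards2 xy.
have [a [b [c [d [U EB]]]]] := design_K4e BD; rewrite {B}EB in BD *.
have Ubacd : uniq [:: b; a; c; d].
  by move: U; rewrite /= !inE !negb_or (eq_sym b a) => /and4P[/and3P[-> -> ->] /andP[-> ->] -> _].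
have sw p q r s : uniq [:: p; q; r; s] -> uniq [:: p; q; s; r].
  by rewrite /= !inE !negb_or (eq_sym s r) => /and4P[/and3P[-> -> ->] /andP[-> ->] -> _].
have T1 : tri a b c by apply/triP; exists d.
have T2 : tri a b d by apply/triP; exists c; rewrite K4eCr; split=> //; apply: sw.
have T3 := tri_sym T1; have T4 := tri_sym T2.
(* Five edges of the block, each in two orientations: the first edge is central, the other four join
   a central end to an apex. *)
rewrite !inE !set2_eq => /orP[/orP[/orP[/orP[]|]|]|] /orP[] /andP[/eqP Ex /eqP Ey]; subst x y.
- by left; apply/existsP; exists c.
- by left; apply/existsP; exists c.
- by right; exists b; left.
- by right; exists b; right.
- by right; exists b; left.
- by right; exists b; right.
- by right; exists a; left.
- by right; exists a; right.
- by right; exists a; left.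
- by right; exists a; right.
Qed.

(** The common edge makes the two blocks equal, and comparing their cores rules out that apex and
    central end swap roles. So a noncentral edge lies in only one triangle of the design. *)
Lemma tri_share x y z x' y' z' : tri x y z -> tri x' y' z' ->
  [set x; z] = [set x'; z'] -> [/\ x = x', y = y' & z = z'].
Proof.
case/triP=> d [U BD] /triP[d' [U' BD']] E.
have EB : K4e x y z d = K4e x' y' z' d'.
  by apply: (@design_edge_uniq _ _ [set x; z]) => //; [|rewrite E]; rewrite !inE eqxx ?orbT.
have /eqP := congr1 (@core v) EB; rewrite !core_K4e // set2_eq.
move: U U'; rewrite /= !inE !negb_or => /and4P[/and3P[xy xz _] /andP[yz _] _ _].
move=> /and4P[/and3P[xy' xz' _] /andP[yz' _] _ _].
have /eqP := E; rewrite set2_eq => /orP[] /andP[/eqP Ex /eqP Ez]; subst x' z' => //.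
  by rewrite eqxx (negbTE xy') /= orbF => /eqP.
by rewrite (negbTE xz) (negbTE yz) andbF.
Qed.

Lemma tri_cen x y z : tri x y z -> ~~ cen x z.
Proof.
case/triP=> d [U BD]; apply/negP=> /existsP[w /triP[d' [U' BD']]].
have EB : K4e x y z d = K4e x z w d'.
  by apply: (@design_edge_uniq _ _ [set x; z]); rewrite // !inE eqxx ?orbT.
have /eqP := congr1 (@core v) EB; rewrite !core_K4e // set2_eq.
move: U; rewrite /= !inE !negb_or => /and4P[/and3P[xy xz _] /andP[yz _] _ _].
by rewrite (negbTE yz) (negbTE xz) andbF.
Qed.

(** Only one block contains the edge xy, so both apexes are its outer vertices. This rebuilds blocks
    from the triangles found by the search. *)
Lemma tri_block x y z w : tri x y z -> tri x y w -> z != w -> K4e x y z w \in D.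
Proof.
case/triP=> d [U BD] /triP[d' [U' BD']] zw.
have EB : K4e x y z d = K4e x y w d'.
  by apply: (@design_edge_uniq _ _ [set x; y]); rewrite // !inE eqxx.
have /eqP := EB; rewrite K4e_eq // => /andP[_]; rewrite set2_eq (negbTE zw) /= => /andP[_ /eqP<-] //.
Qed.

(** Both sides count the central edges at [x]; [core] is injective on [D] because blocks sharing an
    edge coincide. *)
Lemma central_count_cen x : central_count x = #|[set y | cen x y]|.
Proof.
have <- : #|[set [set x; y] | y in [set y | cen x y]]| = #|[set y | cen x y]|.
  apply: card_in_imset => y z; rewrite !inE => /cen_neq xy /cen_neq xz /eqP.
  by rewrite set2_eq eqxx (negbTE xz) /= orbF => /eqP.
have <- : #|[set core B | B in [set B in D | x \in core B]]| = central_count x.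
  apply: card_in_imset => B1 B2; rewrite !inE => /andP[D1 _] /andP[D2 _].
  have [a [b [c [d [U EB]]]]] := design_K4e D1; subst B1.
  have [a' [b' [c' [d' [U' EB]]]]] := design_K4e D2; subst B2.
  rewrite !core_K4e // => E.
  by apply: (@design_edge_uniq _ _ [set a; b]) => //; [|rewrite E]; rewrite !inE eqxx.
apply: eq_card => e; apply/imsetP/imsetP=> [[B]|[y]].
  rewrite inE => /andP[BD]; have [a [b [c [d [U EB]]]]] := design_K4e BD; subst B.
  have T : tri a b c by apply/triP; exists d.
  rewrite core_K4e // => xB ->; move: xB; rewrite !inE => /orP[] /eqP->.
    by exists b => //; rewrite inE; apply/existsP; exists c.
  by exists a; [rewrite inE; apply/existsP; exists c; apply: tri_sym|rewrite setUC].
rewrite inE => /existsP[z /triP[d [U BD]]] ->; exists (K4e x y z d); last by rewrite core_K4e.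
by rewrite inE BD core_K4e // set21.
Qed.
End Design.

(** From 3r + 2q = 10 the count r is at most 2. The 11 blocks have 22 central ends in all, so r = 2
    at each of the 11 vertices. *)
Lemma card_cen D (desD : is_design D) (x : 'I_11) : #|[set y | cen D x y]| = 2.
Proof.
rewrite -(central_count_cen desD).
have cD : #|D| = 11.
  by have := card_design desD; rewrite (_ : 'C(11, 2) = 55) // => H; lia.
have le2 y : central_count D y <= 2.
  have [q /= Hq] := central_count_degree desD y; lia.
have := sum_central_count desD; rewrite cD (bigD1 x) //= => S.
have: \sum_(i < 11 | i != x) central_count D i <= \sum_(i < 11 | i != x) 2.
  by apply: leq_sum.
have -> : \sum_(i < 11 | i != x) 2 = 20.
  by rewrite sum_nat_const; have := cardC1 x; rewrite card_ord => ->.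
rewrite -(leq_add2l (central_count D x)) S; have := le2 x; clear; lia.
Qed.

(* Successor table of the permutation of [0, sumn sh) whose cycles are the
   consecutive intervals of lengths [sh]. *)
Fixpoint cycles_succ (sh : seq nat) : seq nat :=
  if sh is n :: sh' then rcons (iota 1 n.-1) 0 ++ map (addn n) (cycles_succ sh')
  else [::].

(** * Cycle decomposition of 2-regular graphs *)

Section TwoRegular.
Variables (T : finType) (e : rel T).
Hypothesis e_sym : symmetric e.
Hypothesis e_irr : irreflexive e.
Hypothesis e2 : forall x, #|[set y | e x y]| = 2.

Lemma two_neighbours x y z w : e x y -> e x z -> y != z -> e x w -> w = y \/ w = z.
Proof.
move=> xy xz yz xw; have: [set y; z] == [set u | e x u].
  rewrite eqEcard e2 cards2 yz andbT.
  by apply/subsetP=> u; rewrite !inE => /orP[] /eqP->.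
move/eqP/setP/(_ w); rewrite !inE xw => /orP[] /eqP->; by [left|right].
Qed.

Lemma other_neighbour x y : e x y -> exists2 z, z != y & e x z.
Proof.
move=> xy; have := cardsD1 y [set u | e x u]; rewrite e2 inE xy => -[/esym/eqP].
by move/cards1P=> [z /setP/(_ z)]; rewrite !inE eqxx => /andP[zy xz]; exists z.
Qed.

(** A vertex of the cycle already has two distinct neighbours on it, the next and the previous
    vertex, hence no others. *)
Lemma cycle_closed c x y : cycle e c -> uniq c -> 2 < size c ->
  x \in c -> e x y -> y \in c.
Proof.
move=> + + + xc; case: (rot_to xc) => i c' Ec.
rewrite -(rot_cycle i) -(rot_uniq i) -(size_rot i c) -(mem_rot i) Ec.
case: c' {Ec} => [|y1 [|y2 c']] //= /and3P[e1 e3 p] /and4P[_ n1 n2 _] _ exy.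
have ex : e x (last y2 c') by move: p; rewrite rcons_path e_sym => /andP[].
have ne : y1 != last y2 c'.
  by apply: contraNneq n1 => ->; rewrite mem_last.
case: (two_neighbours e1 ex ne exy) => ->; rewrite !inE ?eqxx ?orbT //.
by rewrite -[_ || (_ \in c')]in_cons mem_last !orbT.
Qed.

(** A path inside [A] is extended at its head. It cannot outgrow [T], so at some point the second
    neighbour of the head lies on the path and closes a cycle. *)
Lemma exists_cycle (A : {set T}) x : (forall x y, x \in A -> e x y -> y \in A) ->
  x \in A -> exists c, [/\ 2 < size c, uniq c, cycle e c & {subset c <= A}].
Proof.
move=> clA xA; suff H n y s : path e y s -> uniq (y :: s) -> {subset y :: s <= A} ->
    #|T| - size s <= n ->
    exists c, [/\ 2 < size c, uniq c, cycle e c & {subset c <= A}].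
  by apply: (H #|T| x [::]) => //; [move=> z; rewrite inE => /eqP->|rewrite subn0].
(* [n] bounds the room left. It cannot be 0, since the path has [size s + 1] distinct vertices. *)
elim: n y s => [|n IHn] y s ps Us sA le.
  have := uniq_leq_size Us (fun z _ => mem_enum T z); rewrite -cardE /=.
  by move: le; rewrite leqn0 subn_eq0 => le1 le2; have := leq_trans le2 le1; rewrite ltnn.
have yA : y \in A by apply: sA; rewrite mem_head.
have ext z : e y z -> z \notin y :: s ->
    exists c, [/\ 2 < size c, uniq c, cycle e c & {subset c <= A}].
  move=> yz zs; apply: (IHn z (y :: s)); rewrite /= ?[e z y]e_sym ?yz ?ps //.
  - by move: Us zs => /= -> ->.
  - by move=> u; rewrite in_cons => /orP[/eqP->|/sA //]; apply: clA yz.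
  - by move: le; rewrite /=; case: (#|T|) (size s) => // [] //; lia.
case: s ps Us sA le ext => [|y1 s] ps Us sA le ext.
  have /cards2P[z [w [_ /setP/(_ z)]]] : #|[set u | e y u]| == 2 by rewrite e2.
  rewrite !inE eqxx => yz; apply: (ext z); rewrite // inE.
  by apply: contraTneq yz => ->; rewrite e_irr.
have /= /andP[yy1 _] := ps; have [z zy1 yz] := other_neighbour yy1.
have [zs|/ext] := boolP (z \in y :: y1 :: s); last exact.
have {}zs : z \in s.
  move: zs; rewrite !inE (negbTE zy1) /=; case: eqP => // E.
  by rewrite E e_irr in yz.
(* The initial segment of the path from [y] to [z] is the cycle. *)
case/splitPr: zs ps Us sA => s1 s2; rewrite -cat_rcons => ps Us sA.
exists (y :: y1 :: rcons s1 z); split=> //=.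
- by rewrite size_rcons.
- by move: Us; rewrite -!cat_cons cat_uniq => /and3P[].
- move: ps; rewrite /= cat_path [path e y1 (rcons _ y)]rcons_path last_rcons (e_sym z) yz andbT => /andP[-> /andP[-> _]] //.
- by move=> u Hu; apply: sA; rewrite -!cat_cons mem_cat Hu.
Qed.

Lemma size_cycles_succ sh : all (leq 3) sh -> size (cycles_succ sh) = sumn sh.
Proof.
elim: sh => //= n sh IH /andP[n3 /IH{IH}E].
by rewrite size_cat size_rcons size_iota size_map E; lia.
Qed.

(** Peel off one cycle at a time; as cycles are closed under adjacency, so is the remainder. [s]
    lists [A] cycle by cycle and [sh] the lengths, hence [cycles_succ sh] gives the next vertex in
    terms of positions. *)
Lemma cycle_decomposition x0 (A : {set T}) : (forall x y, x \in A -> e x y -> y \in A) ->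
  exists sh s, [/\ all (leq 3) sh, sumn sh = size s, uniq s, s =i A &
    forall i, i < size s -> e (nth x0 s i) (nth x0 s (nth 0 (cycles_succ sh) i))].
Proof.
have [n] := ubnP #|A|; elim: n A => // n IHn A le clA.
have [->|[x xA]] := set_0Vmem A.
  by exists [::], [::]; split=> // u; rewrite inE.
have [c [c3 Uc cc cA]] := exists_cycle clA xA.
pose A' := A :\: [set u in c].
have clA' u w : u \in A' -> e u w -> w \in A'.
  rewrite !inE => /andP[uc uA] uw; rewrite (clA _ _ uA uw) andbT.
  by apply: contra uc => wc; apply: cycle_closed wc _ => //; rewrite e_sym.
have [|sh [s [sh3 Es Us sA' es]]] := IHn A' _ clA'.
  apply: leq_trans (_ : #|A| <= n) => //; apply: proper_card; apply/properP; split; first exact: subsetDl.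
  have cu : nth x c 0 \in c by rewrite mem_nth //; lia.
  by exists (nth x c 0); [apply: cA | rewrite !inE cu].
exists (size c :: sh), (c ++ s); split.
- by rewrite /= c3.
- by rewrite size_cat /= Es.
- rewrite cat_uniq Uc Us andbT; apply/hasPn=> u; rewrite sA' !inE => /andP[] //.
- move=> u; rewrite mem_cat sA' !inE.
  by case uc: (u \in c) => //=; rewrite cA.
move=> i; rewrite size_cat => lei.
have E1 : size (rcons (iota 1 (size c).-1) 0) = size c.
  by rewrite size_rcons size_iota; lia.
rewrite /= !nth_cat E1; case: ifP => ic; last first.
  have ic' : i - size c < size s by rewrite ltn_subLR // leqNgt ic.
  rewrite (nth_map 0) ?size_cycles_succ ?Es // ltnNge leq_addr /= addKn.
  exact: es.
(* Inside the first cycle the table leads to the next position, and from the last one back to 0. *)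
have -> : nth 0 (rcons (iota 1 (size c).-1) 0) i = if i.+1 < size c then i.+1 else 0.
  rewrite nth_rcons size_iota -subn1 ltn_subRL add1n.
  by case: (ltnP i.+1 (size c)) => lt; [rewrite nth_iota ?add1n // subn1 -ltnS (ltn_predK c3) | case: eqP].
have c0 : 0 < size c by exact: leq_trans c3.
case: (ltnP i.+1 (size c)) => lt; rewrite ?lt ?c0.
  case: c cc {c0 c3 Uc cA A' clA' sA' es E1} ic lt lei => // u c /= /(pathP u) H ic lt _.
  have := H i; rewrite size_rcons => /(_ ic); rewrite -rcons_cons !nth_rcons /= ic.
  by rewrite -ltnS lt => Hi; rewrite !(set_nth_default u x0).
have Ei : i = (size c).-1 by apply/eqP; rewrite eqn_leq -ltnS (ltn_predK c3) ic /= -ltnS (ltn_predK c3).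
case: c cc {c0 c3 Uc cA A' clA' sA' es E1} ic Ei lei lt => // u c /= + ic Ei _ _.
by rewrite rcons_path Ei nth_last /= => /andP[_].
Qed.
End TwoRegular.

(** * Classification of the designs *)

(** Labels are plain numbers so that the exhaustive checks compute on [nat]; injectivity concerns
    the labels 0, ..., 10. *)
Definition labelling (f : nat -> 'I_11) :=
  forall i j, i < 11 -> j < 11 -> f i = f j -> i = j.

Definition pairs11 :=
  [seq p <- [seq (i, j) | i <- iota 0 11, j <- iota 0 11] | p.1 < p.2].

(** * Search for the triangles over a given 2-factor *)

Section Search.
Variables (nx : seq nat) (es : seq (nat * nat)).
Let succ i := nth 0 nx i.
Let pred i := index i nx.

(* In the search, the pair [(i, w)] stands for the triangle on the central edge
   {i, succ i} with apex [w]. *)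
Definition noncentral a b := [&& a != b, succ a != b & succ b != a].
Definition same_pair (a b c d : nat) := (a == c) && (b == d) || (a == d) && (b == c).
Definition covers a b (t : nat * nat) :=
  same_pair t.1 t.2 a b || same_pair (succ t.1) t.2 a b.
Definition free pos a b := noncentral a b && ~~ has (covers a b) pos.
(** One of the two vertices is the apex, and the central edge is one of the two at the other
    vertex. *)
Definition candidates x y := [:: (x, y); (pred x, y); (y, x); (pred y, x)].
Definition options pos x y :=
  [seq t <- candidates x y | free pos t.1 t.2 && free pos (succ t.1) t.2].
(** Branching on the pair with fewest options keeps the tree small. An empty option list kills the
    branch; [None] means that no listed pair is left to cover. *)
Definition shortest (bs : seq (seq (nat * nat))) : option (seq (nat * nat)) :=
  foldr (fun b r => if r is Some b' then
     if size b < size b' then Some b else r else Some b) None bs.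
Fixpoint search (fuel : nat) (pos : seq (nat * nat)) : seq (seq (nat * nat)) :=
  if fuel is n.+1 then
    if shortest [seq options pos p.1 p.2 | p <- es & free pos p.1 p.2] is Some b
    then flatten [seq search n (t :: pos) | t <- b]
    else [:: pos]
  else [:: pos].

Definition good_succ := (size nx == 11) &&
  all (fun i => [&& succ i < 11, i \in nx & succ (succ i) != i]) (iota 0 11).

Lemma shortest_mem bs b : shortest bs = Some b -> b \in bs.
Proof.
elim: bs b => //= c bs IH b; case: (shortest bs) IH => [b' IH|_ [->]]; last exact: mem_head.
by case: ifP => _ [<-]; rewrite inE ?eqxx // IH ?orbT.
Qed.

Variables (D : {set graph 11}) (f : nat -> 'I_11).
Hypothesis desD : is_design D.
Hypothesis lab : labelling f.
Hypothesis es11 : forall p, p \in es -> (p.1 < 11) && (p.2 < 11).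
Hypothesis good : good_succ.
Hypothesis cenS : forall i, i < 11 -> cen D (f i) (f (succ i)).

Let size_nx : size nx = 11. Proof. by case/andP: good => /eqP. Qed.
Let goodS i : i < 11 -> [/\ succ i < 11, i \in nx & succ (succ i) != i].
Proof.
by move=> i11; apply/and3P; case/andP: good => _ /allP/(_ i)->; rewrite ?mem_iota.
Qed.
Let succ11 i : i < 11 -> succ i < 11. Proof. by case/goodS. Qed.
Let predK i : i < 11 -> succ (pred i) = i.
Proof. by case/goodS => _ ? _; apply: nth_index. Qed.
Let pred11 i : i < 11 -> pred i < 11.
Proof. by case/goodS => _ ? _; rewrite -size_nx index_mem. Qed.

Definition valid (t : nat * nat) :=
  [&& t.1 < 11, t.2 < 11 & tri D (f t.1) (f (succ t.1)) (f t.2)].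

Let neighbour x z : x < 11 -> cen D (f x) z -> z = f (succ x) \/ z = f (pred x).
Proof.
move=> x11; apply: (two_neighbours (card_cen desD)); first exact: cenS.
  by rewrite cen_sym // -{2}(predK x11); apply: cenS; apply: pred11.
apply/eqP=> /(lab (succ11 x11) (pred11 x11)) E.
by case/goodS: (x11) => _ _; rewrite E predK // eqxx.
Qed.

(** The design has a triangle through the pair, and its central edge joins a vertex to its successor
    or predecessor in the 2-factor. *)
Let valid_candidate x y : x < 11 -> y < 11 -> noncentral x y ->
  exists2 t, t \in candidates x y & valid t.
Proof.
move=> x11 y11 /and3P[xy sx sy].
have half u v z : u < 11 -> v < 11 -> tri D (f u) z (f v) ->
    exists2 t, t \in [:: (u, v); (pred u, v)] & valid t.
  move=> u11 v11 T; case: (@neighbour u z) => //; first by apply/existsP; exists (f v).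
    by move=> E; exists (u, v); rewrite ?inE ?eqxx // /valid /= u11 v11 -E.
  move=> E; exists (pred u, v); rewrite ?inE ?eqxx ?orbT // /valid /= pred11 // v11.
  by rewrite predK // -E tri_sym.
case: (@tri_cover _ _ desD (f x) (f y)).
- by apply: contra xy => /eqP/(lab x11 y11)->.
- case/(neighbour x11) => /lab E.
    by rewrite E ?eqxx ?succ11 // in sx.
  by move: sy; rewrite [y]E ?pred11 // predK // eqxx.
case=> z [] /half[]// t tc vt; exists t => //; move: tc; rewrite !inE.
  by case/orP=> ->; rewrite ?orbT.
by case/orP=> ->; rewrite ?orbT.
Qed.

Let valid_noncentral t : valid t -> noncentral t.1 t.2 && noncentral (succ t.1) t.2.
Proof.
case/and3P=> i11 w11 T; set i := t.1 in i11 T *; set w := t.2 in w11 T *.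
have half a b : a < 11 -> tri D (f a) (f b) (f w) -> noncentral a w.
  move=> a11 T'; have [_ aw _] := tri_neq T'; have nc := tri_cen desD T'.
  apply/and3P; split; first by apply: contraNneq aw => ->.
    by apply: contraNneq nc => <-; apply: cenS.
  by apply: contraNneq nc => <-; rewrite cen_sym; apply: cenS.
by rewrite (half _ _ i11 T) (half _ _ (succ11 i11) (tri_sym T)).
Qed.

Let valid_inj a b t t' : valid t -> valid t' -> covers a b t -> covers a b t' -> t = t'.
Proof.
case: t t' => [i w] [i' w'] /and3P[/= i11 w11 T] /and3P[/= i11' w11' T'].
have sp p q : same_pair p q a b -> [set f p; f q] = [set f a; f b].
  by case/orP=> /andP[/eqP-> /eqP->] //; rewrite setUC.
have T2 := tri_sym T; have T2' := tri_sym T'.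
case/orP=> /sp E1 /orP[] /sp; rewrite -{}E1 => /esym E.
- by have [/lab-> // _ /lab->] := tri_share desD T T' E.
- have [/lab E1 /lab E2 _] := tri_share desD T T2' E.
  by have [_ _] := goodS i11; rewrite [succ i]E2 ?succ11 // -E1 ?succ11 ?eqxx.
- have [/lab E1 /lab E2 _] := tri_share desD T2 T' E.
  by have [_ _] := goodS i11; rewrite [succ i]E1 ?succ11 // -E2 ?succ11 ?eqxx.
- by have [_ /lab-> // /lab->] := tri_share desD T2 T2' E.
Qed.

(** The branch that follows [D] is never pruned: the triangle of [D] through the selected pair is
    always among the options. This holds for any fuel, since running out of it returns the partial
    solution. *)
Lemma search_sound n pos : all valid pos ->
  exists2 sol, sol \in search n pos & all valid sol.
Proof.
elim: n pos => [|n IHn] pos vpos /=; first by exists pos; rewrite ?mem_head.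
case E: shortest => [b|]; last by exists pos; rewrite ?mem_head.
have /mapP[[x y]] := shortest_mem E; rewrite mem_filter /= => /andP[fxy].
case/es11/andP=> /= x11 y11 Eb.
have [ncxy ncov] := andP fxy.
have [t tc vt] := valid_candidate x11 y11 ncxy.
have tcov : covers x y t.
  move: tc; rewrite !inE => /or4P[] /eqP->; rewrite /covers /same_pair /= ?predK //;
    by rewrite !eqxx ?orbT.
have [nc1 nc2] := andP (valid_noncentral vt).
(* A chosen triangle sharing an edge with [t] would be [t] itself, which covers the pair assumed
   free. *)
have unc a b' : covers a b' t -> ~~ has (covers a b') pos.
  move=> ct; apply/hasPn=> t' pt'; apply: contra ncov => ct'; apply/hasP; exists t' => //.
  by rewrite -(valid_inj vt (allP vpos _ pt') ct ct').
have tb : t \in b.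
  rewrite Eb mem_filter tc /free nc1 nc2 !unc // /covers /same_pair !eqxx ?orbT //.
have [|sol sols vsol] := IHn (t :: pos); first by rewrite /= vt.
by exists sol => //; apply/flattenP; exists (search n (t :: pos)) => //; apply: map_f.
Qed.
End Search.

(** * Circulant designs and their labellings *)

Definition mod11 n := if leq 11 n then subn n 11 else n.
Definition quad := (nat * nat * nat * nat)%type.
(** The base block [0, 1, t.1 - t.2] developed modulo 11. One subtraction in [mod11] is enough,
    since for the types used all sums are below 22. *)
Definition quads (t : nat * nat) : seq quad :=
  [seq (k, mod11 k.+1, mod11 (k + t.1), mod11 (k + t.2)) | k <- iota 0 11].
Definition blk (f : nat -> 'I_11) (q : quad) : graph 11 :=
  let: (a, b, c, d) := q in K4e (f a) (f b) (f c) (f d).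
Definition des t f : {set graph 11} := [set B in [seq blk f q | q <- quads t]].

Definition types : seq (nat * nat) := [:: (3, 5); (3, 7)].

Definition quad_ok (q : quad) :=
  let: (a, b, c, d) := q in [&& a < 11, b < 11, c < 11, d < 11 & uniq [:: a; b; c; d]].
Definition edge_in x y (q : quad) :=
  let: (a, b, c, d) := q in
  [|| same_pair x y a b, same_pair x y a c, same_pair x y a d,
      same_pair x y b c | same_pair x y b d].

Definition quads_check :=
  all (fun t => [&& uniq (quads t), all quad_ok (quads t) &
    all (fun x => all (fun y => (x != y) ==> (count (edge_in x y) (quads t) == 1))
      (iota 0 11)) (iota 0 11)]) types.
Lemma quads_checked : quads_check. Proof. by vm_compute. Qed.

Section Labelling.
Variable f : nat -> 'I_11.
Hypothesis lab : labelling f.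

Lemma labE i j : i < 11 -> j < 11 -> (f i == f j) = (i == j).
Proof. by move=> i11 j11; apply/eqP/eqP=> [/(lab i11 j11)|->]. Qed.

Lemma lab_onto u : exists2 i, i < 11 & u = f i.
Proof.
have inj : injective (fun i : 'I_11 => f i) by move=> i j /lab E; apply/val_inj/E.
by exists (val (invF inj u)); rewrite ?ltn_ord // (f_invF inj).
Qed.

Lemma edge_blk q x y : quad_ok q -> x < 11 -> y < 11 ->
  ([set f x; f y] \in blk f q) = edge_in x y q.
Proof.
case: q => [[[a b] c] d] /and5P[a11 b11 c11 d11 _] x11 y11.
by rewrite /= !inE !set2_eq !labE // /same_pair !orbA.
Qed.

Lemma uniq_lab q : quad_ok q -> let: (a, b, c, d) := q in uniq [:: f a; f b; f c; f d].
Proof.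
case: q => [[[a b] c] d] /and5P[a11 b11 c11 d11].
by rewrite /= !inE !labE.
Qed.

Section Circulant.
Variable t : nat * nat.
Hypothesis tT : t \in types.

Let quadsP : [/\ uniq (quads t), forall q, q \in quads t -> quad_ok q &
  forall x y, x < 11 -> y < 11 -> x != y -> count (edge_in x y) (quads t) = 1].
Proof.
have /and3P[U /allP ok /allP E] := allP quads_checked _ tT.
split=> // x y x11 y11 xy.
have /E/allP/(_ y) : x \in iota 0 11 by rewrite mem_iota.
by rewrite mem_iota xy => /(_ y11)/eqP.
Qed.

Lemma quads_ok q : q \in quads t -> quad_ok q. Proof. by case: quadsP => _ + _; apply. Qed.

Lemma mem_blk q : q \in quads t -> blk f q \in des t f.
Proof. by move=> qt; rewrite inE map_f. Qed.

Lemma memdes B : B \in des t f -> exists2 q, q \in quads t & B = blk f q.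
Proof. by rewrite inE => /mapP. Qed.

(** The check on labels counts exactly one quadruple for each pair of distinct labels. *)
Lemma quads_edge_inj q1 q2 e : q1 \in quads t -> q2 \in quads t ->
  e \in blk f q1 -> e \in blk f q2 -> q1 = q2.
Proof.
move=> q1t q2t e1.
have [x [y [x11 y11 xy Ee]]] : exists x y, [/\ x < 11, y < 11, x != y & e = [set f x; f y]].
  have := quads_ok q1t; case: q1 q1t e1 => [[[a b] c] d] _ + /and5P[a11 b11 c11 d11].
  rewrite /= !inE !negb_or => /orP[/orP[/orP[/orP[]|]|]|] /eqP-> /and4P[/and3P[? ? ?] /andP[? ?] _ _];
  by [exists a, b|exists a, c|exists a, d|exists b, c|exists b, d].
rewrite {e}Ee in e1 *; rewrite !edge_blk ?quads_ok // in e1 *.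
move=> e2; have [_ _ /(_ x y x11 y11 xy)] := quadsP.
rewrite -size_filter; have: q2 \in filter (edge_in x y) (quads t) by rewrite mem_filter e2.
have: q1 \in filter (edge_in x y) (quads t) by rewrite mem_filter e1.
by case: filter => [|q [|]] //; rewrite !inE => /eqP-> /eqP->.
Qed.

Lemma des_design : is_design (des t f).
Proof.
split=> [B /memdes[q qt ->]|].
  have := uniq_lab (quads_ok qt); case: q qt => [[[a b] c] d] _ U.
  by exists (f a), (f b), (f c), (f d).
split=> [e /eqP/cards2P[u [w [uw ->]]]|B1 B2 /memdes[q1 q1t ->] /memdes[q2 q2t ->]].
  have [x x11 Eu] := lab_onto u; have [y y11 Ew] := lab_onto w; subst u w.
  rewrite labE // in uw; have [_ _ /(_ x y x11 y11 uw)] := quadsP.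
  rewrite -size_filter; case E: filter => [|q s] // _.
  have : q \in filter (edge_in x y) (quads t) by rewrite E mem_head.
  rewrite mem_filter => /andP[eq qt].
  have eB : [set f x; f y] \in blk f q by rewrite edge_blk ?quads_ok.
  exists (blk f q); split; first by rewrite mem_blk.
  by move=> B [/memdes[q' qt' ->]] /(quads_edge_inj qt qt' eB) ->.
move=> ne; rewrite disjoint_subset; apply/subsetP=> e e1; rewrite inE.
by apply: contra ne => e2; rewrite (quads_edge_inj q1t q2t e1 e2).
Qed.

Lemma uniq_blks : uniq [seq blk f q | q <- quads t].
Proof.
case: quadsP => U _ _; rewrite map_inj_in_uniq // => q1 q2 q1t q2t E.
suff [e eq1] : exists e, e \in blk f q1.
  by apply: (quads_edge_inj q1t q2t eq1); rewrite -E.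
by case: q1 {q1t E} => [[[a b] c] d]; exists [set f a; f b]; rewrite /= !inE eqxx.
Qed.

Lemma card_des : #|des t f| = 11.
Proof. by rewrite cardsE (card_uniqP uniq_blks) size_map. Qed.

Definition quad_eq (q q' : quad) :=
  let: (a, b, c, d) := q in let: (a', b', c', d') := q' in
  same_pair a b a' b' && same_pair c d c' d'.

Lemma blk_eq q q' : quad_ok q -> quad_ok q' -> (blk f q == blk f q') = quad_eq q q'.
Proof.
move=> ok ok'; have := uniq_lab ok; have := uniq_lab ok'.
case: q q' ok ok' => [[[a b] c] d] [[[a' b'] c'] d'].
move=> /and5P[a11 b11 c11 d11 _] /and5P[a11' b11' c11' d11' _] U' U.
by rewrite /= K4e_eq // !set2_eq !labE.
Qed.

(** Membership of a block becomes a test on labels, which makes intersections computable. *)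
Lemma in_des q : quad_ok q -> (blk f q \in des t f) = has (quad_eq q) (quads t).
Proof.
move=> ok; rewrite inE; apply/mapP/hasP=> -[q' qt' E]; exists q' => //.
  by rewrite -(blk_eq ok (quads_ok qt')) E.
by apply/eqP; rewrite (blk_eq ok (quads_ok qt')).
Qed.
End Circulant.
End Labelling.

(** * Every design is circulant *)

Definition has_tri nx (sol : seq (nat * nat)) a b c :=
  has (fun s => same_pair s.1 (nth 0 nx s.1) a b && (s.2 == c)) sol.

(* The reflection k -> 1 - k exchanges 3 with 9 and 5 with 7, hence reduces the four
   circulant solutions of the search to the two of [types]. *)
Definition maps := [:: iota 0 11; [:: 1; 0; 10; 9; 8; 7; 6; 5; 4; 3; 2]].

Definition recognised nx sol (t : nat * nat) (m : seq nat) :=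
  all (fun q : quad => let: (a, b, c, d) := q in
    has_tri nx sol (nth 0 m a) (nth 0 m b) (nth 0 m c) &&
    has_tri nx sol (nth 0 m a) (nth 0 m b) (nth 0 m d)) (quads t).

(** The compositions of 11 into parts at least 3, in every order, are the possible lists of cycle
    lengths; four parts would sum to at least 12. *)
Definition shapes := [:: [:: 11]; [:: 3; 8]; [:: 8; 3]; [:: 4; 7]; [:: 7; 4];
  [:: 5; 6]; [:: 6; 5]; [:: 3; 3; 5]; [:: 3; 5; 3]; [:: 5; 3; 3]; [:: 3; 4; 4];
  [:: 4; 3; 4]; [:: 4; 4; 3]].

Lemma shapesP sh : all (leq 3) sh -> sumn sh = 11 -> sh \in shapes.
Proof.
case: sh => [|a [|b [|c [|d sh]]]] //=; last by lia.
- by rewrite addn0 andbT => _ ->.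
- rewrite addn0 andbT => /andP[a3 b3] E; have b8 : b = 11 - a by lia.
  have : a <= 8 by lia.
  by rewrite {}b8 {E b3}; do 9? [case: a a3 => [|a] a3 //].
rewrite addn0 andbT => /and3P[a3 b3 c3] E; have Ec : c = 11 - a - b by lia.
have : b <= 8 - a by lia.
have : a <= 5 by lia.
rewrite {}Ec in c3 E *; move: a3 b3 c3 {E}.
by do 6? [case: a => [|a] //]; do 6? [case: b => [|b] //].
Qed.

(** [recognised] requires every pair {k, k + 1} modulo 11 to be central. A shape with several cycles
    can thus pass only if its search returns no solution. The fuel 22 is the number of triangles of
    a design. *)
Definition search_check :=
  all (fun sh => let nx := cycles_succ sh in good_succ nx &&
    all (fun sol => has (fun t => has (recognised nx sol t) maps) types)
      (search nx pairs11 22 [::])) shapes.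
Lemma search_checked : search_check. Proof. by vm_compute. Qed.

Definition perm11 (m : seq nat) := [&& size m == 11, all (ltn^~ 11) m & uniq m].

Lemma labelling_perm f m : labelling f -> perm11 m -> labelling (f \o nth 0 m).
Proof.
move=> lab /and3P[/eqP sz /allP m11 U] i j i11 j11 /= /lab E.
have H k : k < 11 -> nth 0 m k < 11 by move=> k11; apply: m11; rewrite mem_nth ?sz.
by apply/eqP; rewrite -(nth_uniq 0 _ _ U) ?sz // E ?H.
Qed.

Lemma design_standard D : is_design D ->
  exists t f, [/\ t \in types, labelling f & D = des t f].
Proof.
move=> desD.
have irr : irreflexive (cen D) by move=> x; apply/negbTE/negP=> /cen_neq; rewrite eqxx.
have [|sh [s [sh3 Es Us sT es]]] :=
  cycle_decomposition (@cen_sym _ D) irr (card_cen desD) ord0 (A := setT).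
  by move=> x y; rewrite !inE.
have s11 : size s = 11.
  by rewrite -(card_uniqP Us) (eq_card sT) cardsT card_ord.
have /andP[good /allP check] := allP search_checked _ (shapesP sh3 (etrans Es s11)).
pose f i : 'I_11 := nth ord0 s i.
have lab : labelling f.
  by move=> i j i11 j11 /eqP; rewrite /f nth_uniq ?s11 // => /eqP.
have cenS i : i < 11 -> cen D (f i) (f (nth 0 (cycles_succ sh) i)).
  by move=> i11; apply: es; rewrite s11.
have [|sol sols /allP vsol] := @search_sound _ pairs11 D f desD lab _ good cenS 22 [::] isT.
  by move=> p; rewrite mem_filter => /andP[_ /allpairsP[[x y] [+ + ->]]];
    rewrite !mem_iota /= => -> ->.
have /hasP[t tT /hasP[m mM /allP rec]] := check _ sols.
have pm : perm11 m by move: mM; rewrite !inE => /orP[] /eqP->.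
have lab' := labelling_perm lab pm.
have T a b c : has_tri (cycles_succ sh) sol (nth 0 m a) (nth 0 m b) (nth 0 m c) ->
    tri D (f (nth 0 m a)) (f (nth 0 m b)) (f (nth 0 m c)).
  case/hasP=> s' /vsol /and3P[_ _ Ts] /andP[sp /eqP <-].
  by case/orP: sp => /andP[/eqP<- /eqP<-] //; apply: tri_sym.
exists t, (f \o nth 0 m); split=> //; apply/esym/eqP.
(* Both triangles of each circulant block lie in [D], hence so does the block; both designs have 11
   blocks, so the inclusion is an equality. *)
rewrite eqEcard card_des // -(leq_pmul2l (isT : 0 < 5)) card_design // andbT.
apply/subsetP=> B /memdes[q qt ->]; have := uniq_lab lab' (quads_ok tT qt).
case: q qt (rec _ qt) => [[[a b] c] d] _ /andP[/T T1 /T T2].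
rewrite /= !inE !negb_or => /and4P[_ _ cd _]; exact: tri_block T1 T2 cd.
Qed.

(** * Intersections of two designs *)

(* [eqn] instead of [==]: the exhaustive tests must also reduce fast without the
   virtual machine. *)
Definition circ_block (t : nat * nat) (a b c d : nat) :=
  let chk k := let u := mod11 (k + t.1) in let w := mod11 (k + t.2) in
    if eqn c u then eqn d w else if eqn c w then eqn d u else false in
  if eqn b (mod11 a.+1) then chk a
  else if eqn a (mod11 b.+1) then chk b else false.

Definition triple := (nat * nat * nat)%type.
Definition triples (t : nat * nat) : seq triple :=
  flatten [seq (let: (a, b, c, d) := q in [:: (a, b, c); (a, b, d)]) | q : quad <- quads t].
(** Between triples of distinct labels, inclusion is already equality of the underlying sets. *)
Definition triple_eq (x y : triple) :=
  let: (a, b, c) := x in let: (a', b', c') := y in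
  let mem3 u := eqn u a' || eqn u b' || eqn u c' in
  [&& mem3 a, mem3 b & mem3 c].
Definition is_triple t x := has (triple_eq x) (triples t).
Definition triple_ok (x : triple) :=
  let: (a, b, c) := x in [&& a < 11, b < 11, c < 11 & uniq [:: a; b; c]].

Definition common_blocks t1 t2 p :=
  count (fun q : quad => let: (a, b, c, d) := q in
    circ_block t1 (nth 0 p a) (nth 0 p b) (nth 0 p c) (nth 0 p d)) (quads t2).
Definition common_triples t1 t2 p :=
  count (fun x : triple => let: (a, b, c) := x in
    is_triple t1 (nth 0 p a, nth 0 p b, nth 0 p c)) (triples t2).

(* Pairs (number of common blocks, number of common triangles), at least 3 blocks. *)
Definition allowed3 : seq (nat * nat) :=
  [:: (3, 7); (3, 8); (3, 9); (3, 10); (3, 11); (3, 12); (3, 13); (3, 14);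
      (4, 9); (4, 10); (4, 11); (4, 12); (4, 13); (4, 15);
      (5, 13); (5, 14); (5, 15); (5, 16); (6, 14); (11, 22)].

Definition leaf t1 t2 p :=
  let s := common_blocks t1 t2 p in
  if leq s 2 then true
  else let c := common_triples t1 t2 p in
    has (fun x => eqn x.1 s && eqn x.2 c) allowed3.

(** [acc] is the reversed prefix. Values already used are skipped, so only injective choices reach
    [chk]. *)
Fixpoint all_extensions (chk : seq nat -> bool) (ls : seq (seq nat)) (acc : seq nat) : bool :=
  if ls is l :: ls' then
    all (fun v => if has (eqn v) acc then true else all_extensions chk ls' (v :: acc)) l
  else chk (rev acc).

(* The positions allowed for each vertex by a relabelling mapping block 0 of the
   second design to block 0 of the first one. *)
Definition fixing (t1 t2 : nat * nat) : seq (seq nat) :=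
  [seq if n <= 1 then [:: 0; 1]
       else if eqn n t2.1 || eqn n t2.2 then [:: t1.1; t1.2] else iota 0 11
  | n <- iota 0 11].

Definition pairs_check t1 t2 := all_extensions (leaf t1 t2) (fixing t1 t2) [::].

Lemma pairs_check00 : pairs_check (3, 5) (3, 5). Proof. by vm_compute. Qed.
Lemma pairs_check01 : pairs_check (3, 5) (3, 7). Proof. by vm_compute. Qed.
Lemma pairs_check10 : pairs_check (3, 7) (3, 5). Proof. by vm_compute. Qed.
Lemma pairs_check11 : pairs_check (3, 7) (3, 7). Proof. by vm_compute. Qed.

(** Certifies the fast test [circ_block], which reads k off the central edge, against a scan of the
    block list. *)
Definition circ_block_check :=
  all (fun t => all (fun a => all (fun b => all (fun c => all (fun d =>
    has (quad_eq (a, b, c, d)) (quads t) == circ_block t a b c d)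
  (iota 0 11)) (iota 0 11)) (iota 0 11)) (iota 0 11)) types.
Lemma circ_block_checked : circ_block_check. Proof. by vm_compute. Qed.

(** The triangles abc and abd share the edge ab, which lies in one block only. They are therefore
    the two triangles of that block, and ab is its central edge. *)
Definition two_triples_check :=
  all (fun t => all (fun a => all (fun b => all (fun c =>
    if is_triple t (a, b, c) then all (fun d =>
      [==> quad_ok (a, b, c, d), is_triple t (a, b, d) => circ_block t a b c d])
    (iota 0 11) else true) (iota 0 11)) (iota 0 11)) (iota 0 11)) types.
Lemma two_triples_checked : two_triples_check. Proof. by vm_compute. Qed.

Definition triples_check :=
  all (fun t => [&& uniq (triples t), all triple_ok (triples t) &
    all (fun x => all (fun y => triple_eq x y ==> (x == y)) (triples t)) (triples t)]) types.
Lemma triples_checked : triples_check. Proof. by vm_compute. Qed.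

Definition map_quad (p : seq nat) (q : quad) : quad :=
  let: (a, b, c, d) := q in (nth 0 p a, nth 0 p b, nth 0 p c, nth 0 p d).

(** Adding k modulo 11 is an automorphism of the circulant design and takes block 0 to block k. *)
Definition rotation_check :=
  all (fun t => all (fun k => let r := rot k (iota 0 11) in
    [&& map (map_quad r) (quads t) == rot k (quads t), perm11 r &
        map_quad r (0, 1, t.1, t.2) == (k, mod11 k.+1, mod11 (k + t.1), mod11 (k + t.2))])
    (iota 0 11)) types.
Lemma rotation_checked : rotation_check. Proof. by vm_compute. Qed.

Definition excluded : seq (nat * nat) :=
  [:: (3, 0); (4, 0); (4, 6); (5, 0); (5, 1); (5, 2); (6, 0); (6, 1); (6, 3); (6, 4)].

Lemma excluded_checked :
  all (fun x => ~~ ((x.1 <= 2) || ((x.1, x.2 + 2 * x.1) \in allowed3))) excluded.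
Proof. by vm_compute. Qed.

(* [(s, t, t2, p)]: the design of type (3, 5) and the one of type [t2] relabelled by [p]
   witness [Fin 11 s t]. *)
Definition examples : seq (nat * nat * (nat * nat) * seq nat) := [::
  (0, 0, (3, 5), [:: 0; 1; 2; 4; 3; 6; 5; 8; 9; 10; 7]);
  (0, 1, (3, 5), [:: 0; 1; 2; 3; 5; 4; 7; 8; 10; 6; 9]);
  (0, 2, (3, 5), [:: 0; 1; 2; 3; 4; 6; 5; 8; 9; 10; 7]);
  (0, 3, (3, 5), [:: 0; 1; 2; 3; 4; 6; 5; 8; 10; 7; 9]);
  (0, 4, (3, 5), [:: 0; 1; 2; 3; 4; 6; 5; 7; 9; 10; 8]);
  (0, 5, (3, 5), [:: 0; 1; 2; 3; 4; 6; 5; 9; 10; 8; 7]);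
  (0, 6, (3, 5), [:: 0; 1; 2; 3; 4; 6; 8; 7; 9; 10; 5]);
  (0, 7, (3, 5), [:: 0; 1; 2; 3; 4; 7; 8; 6; 10; 5; 9]);
  (0, 8, (3, 5), [:: 0; 1; 2; 3; 4; 7; 8; 9; 10; 5; 6]);
  (0, 9, (3, 5), [:: 0; 1; 2; 4; 8; 7; 6; 10; 3; 5; 9]);
  (0, 10, (3, 5), [:: 0; 1; 2; 5; 8; 7; 6; 3; 10; 4; 9]);
  (0, 11, (3, 5), [:: 0; 1; 4; 6; 9; 3; 2; 10; 7; 5; 8]);
  (1, 0, (3, 5), [:: 0; 1; 2; 4; 3; 7; 10; 5; 9; 8; 6]);
  (1, 1, (3, 5), [:: 0; 1; 2; 3; 5; 4; 10; 9; 8; 7; 6]);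
  (1, 2, (3, 5), [:: 0; 1; 2; 3; 4; 5; 7; 8; 10; 6; 9]);
  (1, 3, (3, 5), [:: 0; 1; 2; 3; 4; 5; 7; 6; 9; 10; 8]);
  (1, 4, (3, 5), [:: 0; 1; 2; 3; 4; 5; 7; 9; 6; 10; 8]);
  (1, 5, (3, 5), [:: 0; 1; 2; 3; 4; 5; 7; 9; 10; 6; 8]);
  (1, 6, (3, 5), [:: 0; 1; 2; 3; 4; 5; 8; 9; 10; 6; 7]);
  (1, 7, (3, 5), [:: 0; 1; 2; 3; 4; 5; 8; 9; 7; 10; 6]);
  (1, 8, (3, 5), [:: 0; 1; 2; 3; 7; 5; 8; 9; 10; 4; 6]);
  (1, 9, (3, 5), [:: 0; 1; 2; 3; 9; 6; 5; 7; 10; 4; 8]);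
  (1, 10, (3, 5), [:: 0; 1; 2; 5; 6; 3; 9; 8; 10; 4; 7]);
  (2, 0, (3, 5), [:: 0; 1; 2; 4; 5; 10; 7; 3; 9; 8; 6]);
  (2, 1, (3, 5), [:: 0; 1; 2; 3; 4; 9; 6; 10; 8; 7; 5]);
  (2, 2, (3, 5), [:: 0; 1; 2; 3; 4; 5; 6; 8; 9; 10; 7]);
  (2, 3, (3, 5), [:: 0; 1; 2; 3; 4; 5; 7; 6; 10; 9; 8]);
  (2, 4, (3, 5), [:: 0; 1; 2; 3; 4; 5; 6; 8; 10; 7; 9]);
  (2, 5, (3, 5), [:: 0; 1; 2; 3; 4; 5; 6; 8; 10; 9; 7]);
  (2, 6, (3, 5), [:: 0; 1; 2; 3; 4; 5; 6; 9; 10; 8; 7]);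
  (2, 7, (3, 5), [:: 0; 1; 2; 3; 6; 5; 4; 9; 10; 8; 7]);
  (2, 8, (3, 5), [:: 0; 1; 2; 5; 4; 3; 10; 7; 9; 8; 6]);
  (2, 9, (3, 5), [:: 0; 1; 2; 3; 8; 7; 6; 5; 4; 10; 9]);
  (3, 1, (3, 5), [:: 0; 1; 2; 6; 5; 4; 10; 7; 8; 9; 3]);
  (3, 2, (3, 5), [:: 0; 1; 2; 3; 4; 7; 6; 10; 8; 9; 5]);
  (3, 3, (3, 5), [:: 0; 1; 2; 3; 4; 5; 6; 8; 7; 10; 9]);
  (3, 4, (3, 5), [:: 0; 1; 2; 3; 4; 5; 6; 7; 9; 10; 8]);
  (3, 5, (3, 5), [:: 0; 1; 2; 3; 4; 5; 10; 7; 9; 8; 6]);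
  (3, 6, (3, 5), [:: 0; 1; 2; 3; 6; 5; 7; 8; 4; 10; 9]);
  (3, 7, (3, 5), [:: 0; 1; 2; 3; 6; 5; 4; 10; 8; 9; 7]);
  (3, 8, (3, 5), [:: 0; 1; 2; 3; 9; 5; 6; 7; 10; 4; 8]);
  (4, 1, (3, 7), [:: 0; 5; 4; 10; 9; 3; 2; 8; 7; 6; 1]);
  (4, 2, (3, 7), [:: 0; 1; 2; 5; 4; 10; 9; 3; 6; 8; 7]);
  (4, 3, (3, 5), [:: 0; 1; 2; 3; 6; 5; 4; 8; 9; 10; 7]);
  (4, 4, (3, 5), [:: 0; 1; 2; 3; 4; 5; 6; 10; 8; 9; 7]);
  (4, 5, (3, 5), [:: 0; 1; 2; 3; 4; 5; 6; 9; 10; 7; 8]);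
  (4, 7, (3, 7), [:: 0; 1; 6; 5; 2; 10; 3; 4; 9; 8; 7]);
  (5, 3, (3, 5), [:: 0; 1; 2; 3; 6; 5; 4; 8; 7; 10; 9]);
  (5, 4, (3, 5), [:: 0; 1; 2; 3; 4; 5; 6; 7; 8; 10; 9]);
  (5, 5, (3, 7), [:: 0; 1; 6; 5; 4; 10; 9; 2; 3; 8; 7]);
  (5, 6, (3, 5), [:: 0; 1; 2; 3; 6; 5; 4; 10; 9; 8; 7]);
  (6, 2, (3, 5), [:: 0; 1; 2; 3; 4; 5; 6; 7; 10; 9; 8]);
  (11, 0, (3, 5), [:: 0; 1; 2; 3; 4; 5; 6; 7; 8; 9; 10])].

Definition examples_check :=
  all (fun x => let: (s, t, t2, p) := x in
    [&& t2 \in types, perm11 p, common_blocks (3, 5) t2 p == s &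
        common_triples (3, 5) t2 p == t + 2 * s]) examples.
Lemma examples_checked : examples_check. Proof. by vm_compute. Qed.

(** Only necessary conditions for admissibility enter. At most two common blocks give at most 13 =
    11 + 2 common triangles; all other block and triangle numbers are listed in [allowed3]. *)
Definition arithmetic_check :=
  all (fun s => all (fun t => [==> s + t <= 11, (s <= 2) || (s \in map fst allowed3),
      (t + 2 * s <= 13) || (t + 2 * s \in map snd allowed3), (s, t) \notin excluded =>
      (s, t) \in [seq x.1.1 | x <- examples]]) (iota 0 12)) (iota 0 12).
Lemma arithmetic_checked : arithmetic_check. Proof. by vm_compute. Qed.

(** * Intersection sizes as counts on labels *)

Lemma card_setI_seq (T : finType) (X : {set T}) (s : seq T) : uniq s ->
  #|X :&: [set x in s]| = count [in X] s.
Proof.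
move=> U; rewrite -size_filter -(card_uniqP (filter_uniq _ U)).
by apply: eq_card => x; rewrite !inE mem_filter.
Qed.

Lemma circ_blockE t q : t \in types -> quad_ok q ->
  has (quad_eq q) (quads t) = let: (a, b, c, d) := q in circ_block t a b c d.
Proof.
move=> tT; case: q => [[[a b] c] d] /and5P[a11 b11 c11 d11 _].
have m i : i < 11 -> i \in iota 0 11 by move=> i11; rewrite mem_iota.
have /allP/(_ _ (m _ a11))/allP/(_ _ (m _ b11)) := allP circ_block_checked _ tT.
by move=> /allP/(_ _ (m _ c11))/allP/(_ _ (m _ d11))/eqP.
Qed.

Lemma triplesP t : t \in types -> [/\ uniq (triples t),
  forall x, x \in triples t -> triple_ok x &
  forall x y, x \in triples t -> y \in triples t -> triple_eq x y -> x = y].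
Proof.
move=> tT; have /and3P[U /allP ok /allP E] := allP triples_checked _ tT; split=> // x y xt yt.
by have /allP/(_ _ yt)/implyP H := E _ xt; move/H/eqP.
Qed.

Definition tset (f : nat -> 'I_11) (x : triple) : {set 'I_11} :=
  let: (a, b, c) := x in [set f a; f b; f c].

Section Labelled.
Variable f : nat -> 'I_11.
Hypothesis lab : labelling f.

Lemma tset_eq x y : triple_ok x -> triple_ok y -> (tset f x == tset f y) = triple_eq x y.
Proof.
case: x y => [[a b] c] [[a' b'] c'] /and4P[a11 b11 c11 U] /and4P[a11' b11' c11' U'].
rewrite /= set3_eq; first by rewrite !inE !labE // !eqnE !orbA.
  by move: U; rewrite /= !inE !labE.
by move: U'; rewrite /= !inE !labE.
Qed.

Lemma Tset_des t : t \in types -> Tset (des t f) = [set T in map (tset f) (triples t)].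
Proof.
move=> tT; apply/setP=> T; rewrite inE; apply/bigcupP/mapP.
  case=> B /memdes[q qt ->]; have := uniq_lab lab (quads_ok tT qt).
  case: q qt => [[[a b] c] d] qt U; rewrite /= triangles_K4e // => /set2P TB.
  have H x : x \in [:: (a, b, c); (a, b, d)] -> x \in triples t.
    move=> xq; apply/flattenP; exists [:: (a, b, c); (a, b, d)] => //.
    by apply/mapP; exists (a, b, c, d).
  by case: TB => ->; [exists (a, b, c)|exists (a, b, d)]; rewrite // H // !inE eqxx ?orbT.
case=> x /flattenP[xs /mapP[q qt ->]] xq ->; exists (blk f q).
  exact: mem_blk.
have := uniq_lab lab (quads_ok tT qt); case: q xq {qt} => [[[a b] c] d] xq U.
rewrite triangles_K4e //; apply/set2P; move: xq.
by rewrite !inE => /orP[] /eqP->; [left|right].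
Qed.

Lemma in_Tset t x : t \in types -> triple_ok x ->
  (tset f x \in Tset (des t f)) = is_triple t x.
Proof.
move=> tT ok; rewrite Tset_des // inE; have [_ tok _] := triplesP tT.
apply/mapP/hasP=> -[y yt E]; exists y => //.
  by rewrite -(tset_eq ok (tok _ yt)) E.
by apply/eqP; rewrite (tset_eq ok (tok _ yt)).
Qed.

Lemma uniq_tsets t : t \in types -> uniq (map (tset f) (triples t)).
Proof.
move=> tT; have [U ok inj] := triplesP tT.
by rewrite map_inj_in_uniq // => x y xt yt /eqP; rewrite tset_eq ?ok // => /inj ->.
Qed.
End Labelled.

Lemma des_ext t f g : t \in types -> (forall i, i < 11 -> f i = g i) -> des t f = des t g.
Proof.
move=> tT fg; rewrite /des; suff -> : map (blk f) (quads t) = map (blk g) (quads t) by [].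
apply/eq_in_map => -[[[a b] c] d] /(quads_ok tT).
by case/and5P=> ? ? ? ? _; rewrite /= !fg.
Qed.

Section Relabelled.
Variables (t1 t2 : nat * nat) (f : nat -> 'I_11) (p : seq nat).
Hypotheses (tT1 : t1 \in types) (tT2 : t2 \in types) (lab : labelling f) (pp : perm11 p).
Let g := f \o nth 0 p.

Let labg : labelling g. Proof. exact: labelling_perm. Qed.

Let p11 i : i < 11 -> nth 0 p i < 11.
Proof. by case/and3P: pp => /eqP sz /allP H _ i11; apply: H; rewrite mem_nth ?sz. Qed.

Let p_eq i j : i < 11 -> j < 11 -> (nth 0 p i == nth 0 p j) = (i == j).
Proof. by case/and3P: pp => /eqP sz _ U i11 j11; rewrite nth_uniq ?sz. Qed.

Lemma map_quad_ok q : quad_ok q -> quad_ok (map_quad p q).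
Proof.
case: q => [[[a b] c] d] /and5P[a11 b11 c11 d11 U].
by move: U; rewrite /= !p11 //= !inE !p_eq.
Qed.

Lemma card_common_blocks : #|des t1 f :&: des t2 g| = common_blocks t1 t2 p.
Proof.
rewrite card_setI_seq ?(uniq_blks labg) // count_map; apply: eq_in_count => q qt /=.
have ok := map_quad_ok (quads_ok tT2 qt).
have -> : blk g q = blk f (map_quad p q) by case: q {qt ok} => [[[a b] c] d].
by rewrite in_des // circ_blockE //; case: q {qt ok} => [[[a b] c] d].
Qed.

Lemma card_common_triples : #|Tset (des t1 f) :&: Tset (des t2 g)| = common_triples t1 t2 p.
Proof.
rewrite [Tset (des t2 g)]Tset_des // card_setI_seq ?uniq_tsets // count_map.
apply: eq_in_count => -[[a b] c] xt /=.
have [_ /(_ _ xt) /and4P[a11 b11 c11 U] _] := triplesP tT2.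
rewrite -[[set _; _; _]]/(tset f (nth 0 p a, nth 0 p b, nth 0 p c)) in_Tset //.
by move: U; rewrite /= !p11 //= !inE !p_eq.
Qed.

(** Each of the 11 blocks contributes at most one common triangle, or two if the block itself is
    common. For t + 2s common triangles this says s + t <= 11. *)
Lemma common_triples_le : common_triples t1 t2 p <= 11 + common_blocks t1 t2 p.
Proof.
rewrite /common_triples /triples /common_blocks.
have -> : 11 = size (quads t2) by rewrite size_map.
have ok q : q \in quads t2 -> quad_ok (map_quad p q) by move/(quads_ok tT2)/map_quad_ok.
elim: (quads t2) ok => //= -[[[a b] c] d] qs IH ok /=.
have {}IH := IH (fun q qq => ok q (mem_behead (s := _ :: qs) qq)).
have := ok _ (mem_head _ _); rewrite [map_quad _ _]/=.
set a' := nth 0 p a; set b' := nth 0 p b; set c' := nth 0 p c; set d' := nth 0 p d.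
move=> okq; have : is_triple t1 (a', b', c') -> is_triple t1 (a', b', d') ->
    circ_block t1 a' b' c' d'.
  case/and5P: (okq) => a11 b11 c11 d11 _ T1 T2.
  have m i : i < 11 -> i \in iota 0 11 by move=> i11; rewrite mem_iota.
  have /allP/(_ _ (m _ a11))/allP/(_ _ (m _ b11)) := allP two_triples_checked _ tT1.
  move=> /allP/(_ _ (m _ c11)); rewrite T1 => /allP/(_ _ (m _ d11)).
  by rewrite okq T2.
move: IH; do 2 case: is_triple; case: circ_block => //= IH H; try (by have := H isT isT);
  lia.
Qed.
End Relabelled.

(** * Normalising a pair of designs *)

Lemma relabel f g : labelling f -> labelling g ->
  exists2 p, perm11 p & forall i, i < 11 -> g i = f (nth 0 p i).
Proof.
move=> lf lg; pose h i := index (g i) [seq f j | j <- iota 0 11].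
have gf i : g i \in [seq f j | j <- iota 0 11].
  by have [j j11 ->] := lab_onto lf (g i); apply: map_f; rewrite mem_iota.
have h11 i : h i < 11 by have := gf i; rewrite -index_mem size_map size_iota.
have fh i : f (h i) = g i.
  have := nth_index (g 0) (gf i).
  by rewrite (nth_map 0) ?size_iota ?h11 // nth_iota ?h11.
exists (map h (iota 0 11)).
  apply/and3P; split; first by rewrite size_map size_iota.
    by apply/allP=> u /mapP[i _ ->]; apply: h11.
  rewrite map_inj_in_uniq ?iota_uniq // => i j; rewrite !mem_iota => /= i11 j11 E.
  by apply: lg => //; rewrite -!fh E.
by move=> i i11; rewrite (nth_map 0) ?size_iota // nth_iota // fh.
Qed.

Lemma rotate t f q : t \in types -> labelling f -> q \in quads t ->
  exists f', [/\ labelling f', des t f' = des t f &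
    blk f q = blk f' (0, 1, t.1, t.2)].
Proof.
move=> tT lf /mapP[k k11 Eq].
have /and3P[/eqP Er pr /eqP Eq0] := allP (allP rotation_checked _ tT) _ k11.
exists (f \o nth 0 (rot k (iota 0 11))); split; first exact: labelling_perm.
  apply/setP=> B; rewrite !in_set.
  rewrite (eq_map (g := blk f \o map_quad (rot k (iota 0 11)))); last by case=> [[[a b] c] d].
  by rewrite map_comp Er map_rot mem_rot.
by rewrite Eq -Eq0.
Qed.

Lemma all_extensions_sound chk ls acc p : all_extensions chk ls acc ->
  size p = size ls -> (forall i, i < size ls -> nth 0 p i \in nth [::] ls i) ->
  uniq (rev acc ++ p) -> chk (rev acc ++ p).
Proof.
elim: ls acc p => [|l ls IH] acc p /=; first by move=> + /size0nil->; rewrite cats0.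
case: p => // v p /allP H [sz] Hp; rewrite -cat_rcons -rev_cons => U.
apply: IH => //; last by move=> i; apply: (Hp i.+1).
have := H v (Hp 0 isT); case: ifP => // /hasP[u uacc].
rewrite eqnE => /eqP vu; move: U.
by rewrite rev_cons cat_rcons cat_uniq /= mem_rev vu uacc /= andbF.
Qed.

Lemma leaf_holds t1 t2 p : t1 \in types -> t2 \in types -> perm11 p ->
  has (quad_eq (map_quad p (0, 1, t2.1, t2.2))) [:: (0, 1, t1.1, t1.2)] -> leaf t1 t2 p.
Proof.
move=> tT1 tT2 /and3P[/eqP sz /allP p11 U]; rewrite /= orbF => /andP[h01 huw].
have chk : pairs_check t1 t2.
  move: tT1 tT2; rewrite !inE => /orP[] /eqP-> /orP[] /eqP->.
  - exact: pairs_check00.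
  - exact: pairs_check01.
  - exact: pairs_check10.
  exact: pairs_check11.
(* Since block 0 goes to block 0, the central pair goes to {0, 1} and the outer pair to the outer
   pair, as the lists of [fixing] demand. *)
apply: (all_extensions_sound chk) => //; rewrite size_map size_iota // => n n11.
rewrite (nth_map 0) ?size_iota // nth_iota // add0n !eqnE.
case: ifP => [|_].
  move: h01; rewrite /same_pair.
  by case: n {n11} => [|[|]] // + _; case/orP=> /andP[/eqP E0 /eqP E1];
    rewrite ?E0 ?E1.
case: ifP => [|_]; last by rewrite mem_iota; apply: p11; rewrite mem_nth ?sz.
move: huw; rewrite /same_pair.
by move=> + /orP[] /eqP->; case/orP=> /andP[/eqP Eu /eqP Ew]; rewrite ?Eu ?Ew !inE eqxx ?orbT.
Qed.

(** For s <= 2 only the bound on c is at stake. Otherwise a common block exists; rotating both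
    labellings makes it block 0 of each design, so the relabelling is among the enumerated ones. *)
Lemma intersection_numbers (D1 D2 : {set graph 11}) : is_design D1 -> is_design D2 ->
  let s := #|D1 :&: D2| in let c := #|Tset D1 :&: Tset D2| in
  c <= 11 + s /\ ((s <= 2) || ((s, c) \in allowed3)).
Proof.
move=> /design_standard[t1 [f [tT1 lf ->]]] /design_standard[t2 [g [tT2 lg ->]]] s c.
have [s2|s2] := leqP s 2.
  have [p pp /(des_ext tT2) E] := relabel lf lg; split=> //.
  by rewrite /c /s E card_common_blocks // card_common_triples // common_triples_le.
have /card_gt0P[B] : 0 < #|des t1 f :&: des t2 g| by exact: leq_trans s2.
rewrite inE => /andP[/memdes[q1 qt1 ->] /memdes[q2 qt2 Eq]].
have [f' [lf' Ef Eq1]] := rotate tT1 lf qt1.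
have [g' [lg' Eg Eq2]] := rotate tT2 lg qt2.
have [p pp Eg'] := relabel lf' lg'.
have := card_common_blocks tT1 tT2 lf' pp; have := card_common_triples tT1 tT2 lf' pp.
rewrite -(des_ext tT2 Eg') Ef Eg -/s -/c => Ec Es; split.
  by rewrite Ec Es common_triples_le.
have ok0 t : t \in types -> quad_ok (0, 1, t.1, t.2).
  by rewrite !inE => /orP[] /eqP->.
have : leaf t1 t2 p.
  apply: leaf_holds => //; rewrite /= orbF.
  rewrite -[_ && _]/(quad_eq (map_quad p (0, 1, t2.1, t2.2)) (0, 1, t1.1, t1.2)).
  rewrite -(blk_eq lf') ?ok0 ?map_quad_ok ?ok0 // -Eq1 Eq Eq2 /=.
  have [u11 w11] : t2.1 < 11 /\ t2.2 < 11 by move/ok0: tT2 => /and5P[].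
  by rewrite -!Eg'.
rewrite /leaf -Es -Ec; cbv zeta; case: ifP => [|_ /hasP[[s' c'] m]].
  by rewrite leqNgt s2.
by rewrite !eqnE /= => /andP[/eqP<- /eqP<-].
Qed.

Lemma Fin_example s t : (s, t) \in [seq x.1.1 | x <- examples] -> Fin 11 s t.
Proof.
case/mapP=> -[[[s' t'] t2] p] xe [-> ->].
have /and4P[tT2 pp /eqP Es /eqP Et] := allP examples_checked _ xe.
(* The first design carries the identity labelling of the vertices 0, ..., 10. *)
have lab : labelling (@inord 10).
  by move=> i j i11 j11 /(congr1 val); rewrite /= !inordK.
exists (des (3, 5) (@inord 10)), (des t2 (@inord 10 \o nth 0 p)); split.
- exact: des_design.
- by apply: des_design; first exact: labelling_perm.
- by rewrite card_common_blocks.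
- by rewrite card_common_triples.
Qed.

Theorem theorem4p5 : forall s t : nat,
  Fin 11 s t <->
  (Adm 11 s t /\
   (s, t) \notin [:: (3, 0); (4, 0); (4, 6); (5, 0); (5, 1); (5, 2);
                    (6, 0); (6, 1); (6, 3); (6, 4)]).
Proof.
move=> s t; split.
  move=> [D1 [D2 [d1 d2 Es Et]]]; have [] := intersection_numbers d1 d2.
  rewrite Es Et => le al; split.
    split; first by rewrite /bv; change (11 * (11 - 1) %/ 10) with 11; lia.
    by split; exists D1, D2.
  (* An excluded pair has s >= 3 and (s, t + 2s) outside [allowed3]. *)
  by apply/negP=> /(allP excluded_checked)/negP; apply.
case=> [[+ [[D1 [D2 [d1 d2 Es]]] [D3 [D4 [d3 d4 Et]]]]] nex].
rewrite /bv; change (11 * (11 - 1) %/ 10) with 11 => le; apply: Fin_example.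
have [s12 t12] : s \in iota 0 12 /\ t \in iota 0 12 by rewrite !mem_iota; lia.
have := allP (allP arithmetic_checked _ s12) _ t12; rewrite le nex /=.
(* The values s and t + 2s come from two unrelated pairs of designs: the first restricts s, the
   second t + 2s. *)
have [_ hs] := intersection_numbers d1 d2; have [ht hs'] := intersection_numbers d3 d4.
rewrite Es in hs; rewrite Et in ht hs'.
have -> : (s <= 2) || (s \in map fst allowed3).
  by case/orP: hs => [->//|/(map_f fst)] /= ->; rewrite orbT.
have -> // : (t + 2 * s <= 13) || (t + 2 * s \in map snd allowed3).
case/orP: hs' => [le2|/(map_f snd) /= ->]; last by rewrite orbT.
by rewrite (leq_trans ht) // -[13]/(11 + 2) leq_add2l.
Qed.
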